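(* Work over the semifield $\mathbb{R}_{\max,+}$. Let $\bm{A}$ be a row regular $n\times n$ matrix and let $\bm{C}$ be an $n\times n$ matrix with $\mathop{\mathrm{Tr}}(\bm{C})\leq\mathbb{1}$ such that all columns $\bm{d}_1,\ldots,\bm{d}_n$ of the matrix $\bm{D}=(d_{ij})=\bm{A}\bm{C}^{\ast}$ are regular. Define the scalar $$\Delta=\|\bm{D}\bm{D}^{-}\|.$$ Consider the problem of finding regular vectors $\bm{x}$ with $n$ components that maximize $\|\bm{y}\|\,\|\bm{y}^{-}\|$ subject to $\bm{A}\bm{x}=\bm{y}$ and $\bm{C}\bm{x}\leq\bm{x}$. Then the maximum is equal to $\Delta$, and a regular vector $\bm{x}$ is feasible and attains it if and only if $\bm{x}=\bm{C}^{\ast}\bm{u}$ for some regular vector $\bm{u}=(u_i)$ for which there exist a scalar $\alpha>\mathbb{0}$, an index $k\in\{1,\ldots,n\}$ at which $\|\bm{d}_{i}\|\,\|\bm{d}_{i}^{-}\|$ is maximal over $1\leq i\leq n$, and an index $s\in\{1,\ldots,n\}$ at which $d_{ik}^{-1}$ is maximal over $1\leq i\leq n$, such that $$u_{k}=\alpha\,\|\bm{d}_{k}^{-}\|,\qquad u_{j}\leq\alpha\, d_{sj}^{-1}\quad\text{for all } j\ne k.$$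
   Context: $\mathbb{R}_{\max,+}=\langle\mathbb{R}\cup\{-\infty\},-\infty,0,\max,+\rangle$ is the semifield whose addition $\oplus$ is $\max$, with zero $\mathbb{0}=-\infty$, and whose multiplication $\otimes$ (sign omitted) is ordinary addition, with unit $\mathbb{1}=0$; the multiplicative inverse $x^{-1}$ of $x\in\mathbb{R}$ is $-x$, and the order is the usual one (entrywise for vectors). All scalar, matrix and vector operations in the claim are understood in this semifield. $\bm{I}$ is the identity matrix ($\mathbb{1}$ on the diagonal, $\mathbb{0}$ elsewhere), and $\bm{C}^0=\bm{I}$. For an $n\times n$ matrix $\bm{C}=(c_{ij})$, $\mathop{\mathrm{tr}}\bm{C}=\bigoplus_{i=1}^{n}c_{ii}$ and $\mathop{\mathrm{Tr}}(\bm{C})=\mathop{\mathrm{tr}}\bm{C}\oplus\cdots\oplus\mathop{\mathrm{tr}}\bm{C}^{n}$. When $\mathop{\mathrm{Tr}}(\bm{C})\leq\mathbb{1}$, the asterate of $\bm{C}$ is $\bm{C}^{\ast}=\bm{I}\oplus\bm{C}\oplus\cdots\oplus\bm{C}^{n-1}$. A matrix is row regular if no row consists entirely of $\mathbb{0}$. A vector is regular if none of its components is $\mathbb{0}$; ''all columns of $\bm{D}$ are regular'' means that $\bm{D}$ has no entry equal to $\mathbb{0}$. For a regular column vector $\bm{x}=(x_i)$, $\bm{x}^{-}$ is the row vector with components $x_i^{-1}$. For a matrix $\bm{D}=(d_{ij})$ without entries equal to $\mathbb{0}$, $\bm{D}^{-}$ is the matrix whose $(i,j)$ entry is $d_{ji}^{-1}$.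 For a (row or column) vector or a matrix, $\|\cdot\|$ denotes the $\oplus$-sum (i.e. the maximum) of all its entries. *)

(* Defs.v *)
From HB Require Import structures.
From mathcomp Require Import all_boot all_order all_algebra.
From mathcomp Require Import reals.

Set Implicit Arguments.
Unset Strict Implicit.
Unset Printing Implicit Defensive.

Import Order.TTheory GRing.Theory Num.Theory.
Local Open Scope ring_scope.

(* The carrier of the max-plus semifield: [None] is
   -oo and [Some r] is the real number r.  Once the instances below are
   declared, the ring notations on [maxplus R] denote the max-plus operations:
   [0] is -oo, [1] is the real number 0, [x + y] is the maximum and [x * y]
   is the ordinary sum.  Matrix product, matrix powers, trace and big sums
   over [maxplus R] are then MathComp's semiring ones. *)
Definition maxplus (R : realType) : Type := option R.

HB.instance Definition _ (R : realType) := Choice.on (maxplus R).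

Section MaxPlus.
Variable R : realType.
Implicit Types x y z : maxplus R.

Definition mp_le x y : bool :=
  match x, y with
  | None, _ => true
  | Some _, None => false
  | Some a, Some b => a <= b
  end.

Fact mp_le_refl : reflexive mp_le.
Proof. by case=> [a|] //=. Qed.

Fact mp_le_anti : antisymmetric mp_le.
Proof. by case=> [a|] [b|] //= /le_anti ->. Qed.

Fact mp_le_trans : transitive mp_le.
Proof. by case=> [b|] [a|] [c|] //=; apply: le_trans. Qed.

Fact mp_le_total : total mp_le.
Proof. by case=> [a|] [b|] //=; apply: le_total. Qed.

(* The display [ring_display] makes [<=] and [<] of [ring_scope] denote this
   order. *)
HB.instance Definition _ := Order.Le_isPOrder.Build
  ring_display (maxplus R) mp_le_refl mp_le_anti mp_le_trans.
HB.instance Definition _ := Order.POrder_isTotal.Build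
  ring_display (maxplus R) mp_le_total.

Definition mp_add x y : maxplus R := Order.max x y.

Definition mp_mul x y : maxplus R :=
  match x, y with
  | Some a, Some b => Some (a + b)
  | _, _ => None
  end.

Fact mp_addA : associative mp_add.
Proof. exact: maxA. Qed.

Fact mp_addC : commutative mp_add.
Proof. exact: maxC. Qed.

Fact mp_add0 : left_id (None : maxplus R) mp_add.
Proof. by move=> x; apply/max_idPr. Qed.

HB.instance Definition _ :=
  GRing.isNmodule.Build (maxplus R) mp_addA mp_addC mp_add0.

Fact mp_mulA : associative mp_mul.
Proof. by case=> [a|] [b|] [c|] //=; rewrite addrA. Qed.

Fact mp_mulC : commutative mp_mul.
Proof. by case=> [a|] [b|] //=; rewrite addrC. Qed.

Fact mp_mul1 : left_id (Some 0 : maxplus R) mp_mul.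
Proof. by case=> [a|] //=; rewrite add0r. Qed.

Fact mp_mul_le z x y : x <= y -> mp_mul x z <= mp_mul y z.
Proof.
by case: z x y => [c|] [a|] [b|] // h; rewrite /Order.le /= lerD2r.
Qed.

Fact mp_mulDl : left_distributive mp_mul (@GRing.add (maxplus R)).
Proof.
move=> x y z; rewrite /GRing.add /= /mp_add.
case: (leP x y) => [h|/ltW h]; apply/esym.
  exact/max_idPr/mp_mul_le.
exact/max_idPl/mp_mul_le.
Qed.

Fact mp_mul0 : left_zero (0 : maxplus R) mp_mul.
Proof. by []. Qed.

Fact mp_1neq0 : (Some 0 : maxplus R) != 0.
Proof. by []. Qed.

HB.instance Definition _ := GRing.Nmodule_isComNzSemiRing.Build
  (maxplus R) mp_mulA mp_mulC mp_mul1 mp_mulDl mp_mul0 mp_1neq0.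

(* The value at the non-invertible element [0] is irrelevant; it is [0]. *)
Definition mp_inv x : maxplus R := omap -%R x.

Lemma mp_mulV x : x != 0 -> x * mp_inv x = 1.
Proof. by case: x => [a|] // _; congr Some; rewrite subrr. Qed.

Definition mx_norm m n (A : 'M[maxplus R]_(m, n)) : maxplus R :=
  \sum_i \sum_j A i j.

(* The multiplicative conjugate transpose A^-, also used for vectors. *)
Definition mx_conj m n (A : 'M[maxplus R]_(m, n)) : 'M[maxplus R]_(n, m) :=
  \matrix_(i, j) mp_inv (A j i).

Definition row_regular m n (A : 'M[maxplus R]_(m, n)) : Prop :=
  forall i, exists j, A i j != 0.

Definition regular n (x : 'cV[maxplus R]_n) : Prop := forall i, x i 0 != 0.

Definition Tr n (C : 'M[maxplus R]_n) : maxplus R :=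
  \sum_(1 <= k < n.+1) \tr (C ^+ k).

Definition asterate n (C : 'M[maxplus R]_n) : 'M[maxplus R]_n :=
  \sum_(k < n) C ^+ k.

Definition feasible n (A C : 'M[maxplus R]_n) (x y : 'cV[maxplus R]_n) : Prop :=
  [/\ regular x, A *m x = y & forall i, (C *m x) i 0 <= x i 0].

Definition objective n (y : 'cV[maxplus R]_n) : maxplus R :=
  mx_norm y * mx_norm (mx_conj y).

Definition is_maximum n (A C : 'M[maxplus R]_n) (m : maxplus R) : Prop :=
  (exists x y : 'cV[maxplus R]_n, feasible A C x y /\ objective y = m) /\
  (forall x y : 'cV[maxplus R]_n, feasible A C x y -> objective y <= m).

End MaxPlus.

(* Main.v *)
Require Import Defs.
From HB Require Import structures.
From mathcomp Require Import all_boot all_order all_algebra.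
From mathcomp Require Import reals.

Set Implicit Arguments.
Unset Strict Implicit.
Unset Printing Implicit Defensive.

Import Order.TTheory GRing.Theory Num.Theory.
Local Open Scope ring_scope.

(** Excising a cycle from a walk of length [n] does not decrease its weight,
    because cycles have weight at most [1]; hence [C C^* <= C^*], so [C x <= x]
    iff [x = C^* x], and the feasible [y] are the vectors [D u].  If [p] and
    [s] are indices of a largest and a least entry of [y = D u], and [k] is
    such that [y_p = d_pk u_k], then [y_s >= d_sk u_k], so
    [y_p / y_s <= d_pk / d_sk <= Delta].  Equality forces [d_pk] and [d_sk] to
    be extremal in column [k], the column [k] to have maximal spread, and
    [y_s = d_sk u_k]; with [alpha = y_s] these are the stated conditions. *)

(** * Order, inverses and sums in the max-plus semifield *)

Section MaxPlusOrder.
Variable R : realType.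
Implicit Types x y z : maxplus R.

Lemma mp_addE x y : x + y = Order.max x y. Proof. by []. Qed.

Lemma mp_ge0 x : (0 : maxplus R) <= x. Proof. by []. Qed.

Lemma mp_gt0 x : ((0 : maxplus R) < x) = (x != 0).
Proof. by rewrite lt_neqAle mp_ge0 andbT eq_sym. Qed.

Lemma mp_mul_eq0 x y : (x * y == 0) = (x == 0) || (y == 0).
Proof. by case: x y => [a|] [b|]. Qed.

Lemma mp_inv_neq0 x : x != 0 -> mp_inv x != 0.
Proof. by case: x. Qed.

Lemma mp_invM x y : mp_inv (x * y) = mp_inv x * mp_inv y.
Proof. by case: x y => [a|] [b|] //; congr Some; rewrite opprD. Qed.

Lemma mp_invK : involutive (@mp_inv R).
Proof. by case=> [a|] //; congr Some; rewrite opprK. Qed.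

Lemma mp_leM x y z t : x <= y -> z <= t -> x * z <= y * t.
Proof.
move=> xy zt; apply: (@le_trans _ _ (y * z)); first exact: (mp_mul_le z xy).
rewrite ![y * _]mulrC; exact: (mp_mul_le y zt).
Qed.

Lemma mp_leM2r x y z : z != 0 -> (x * z <= y * z) = (x <= y).
Proof.
move=> z0; apply/idP/idP => [|xy]; last exact: mp_leM.
move/(mp_leM (lexx (mp_inv z))).
by rewrite ![mp_inv z * _]mulrC -!mulrA mp_mulV ?mulr1.
Qed.

Lemma mp_leM2l x y z : z != 0 -> (z * x <= z * y) = (x <= y).
Proof. by rewrite ![z * _]mulrC; exact: mp_leM2r. Qed.

Lemma mp_mulI x y z : z != 0 -> z * x = z * y -> x = y.
Proof.
by move=> z0 e; apply/le_anti; rewrite -(mp_leM2l x y z0) -(mp_leM2l y x z0) e lexx.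
Qed.

Lemma mp_mulKV x z : z != 0 -> x * z * mp_inv z = x.
Proof. by move=> z0; rewrite -mulrA mp_mulV ?mulr1. Qed.

Lemma mp_mulVK x z : z != 0 -> x * mp_inv z * z = x.
Proof. by move=> z0; rewrite -mulrA [_ * z]mulrC mp_mulV ?mulr1. Qed.

Lemma mp_le_pdivl x y z : z != 0 -> (x <= y * mp_inv z) = (z * x <= y).
Proof. by move=> z0; rewrite -(mp_leM2r _ _ z0) mp_mulVK // mulrC. Qed.

(* The hypothesis [x != 0] cannot be dropped, as [mp_inv 0 = 0]. *)
Lemma mp_le_inv x y : x != 0 -> x <= y -> mp_inv y <= mp_inv x.
Proof. by case: x y => [a|] [b|] // _; rewrite /Order.le /= lerN2. Qed.

Lemma mp_sum_le (I : Type) (r : seq I) (P : pred I) (F : I -> maxplus R) z :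
  (forall i, P i -> F i <= z) -> \sum_(i <- r | P i) F i <= z.
Proof.
move=> Fz; elim/big_ind: _ => // x y xz yz.
by rewrite mp_addE ge_max xz.
Qed.

Lemma mp_le_sum (I : eqType) (r : seq I) (F : I -> maxplus R) i :
  i \in r -> F i <= \sum_(j <- r) F j.
Proof. by move=> ir; rewrite (big_rem i) //= mp_addE le_max lexx. Qed.

Lemma mp_le_sumT (I : finType) (F : I -> maxplus R) i : F i <= \sum_j F j.
Proof. by apply: mp_le_sum; rewrite mem_index_enum. Qed.

(** A finite sum is a maximum, hence attained. The index [i0] excludes the empty sum, which is [0]
    and attained nowhere. *)
Lemma mp_sum_max (I : finType) (i0 : I) (F : I -> maxplus R) :
  exists i, \sum_j F j = F i.
Proof.
case: (@arg_maxP _ _ _ i0 predT F isT) => i _ Fi; exists i.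
by apply/le_anti; rewrite mp_le_sumT mp_sum_le // => j _; apply: Fi.
Qed.

Lemma mx_norm_ge m n (A : 'M[maxplus R]_(m, n)) i j : A i j <= mx_norm A.
Proof.
apply: le_trans (mp_le_sumT (fun i => \sum_j A i j) i).
exact: (mp_le_sumT (A i)).
Qed.

Lemma mx_norm_max m n (A : 'M[maxplus R]_(m, n)) (i0 : 'I_m) (j0 : 'I_n) :
  exists i j, mx_norm A = A i j.
Proof.
rewrite /mx_norm; have [i ->] := mp_sum_max i0 (fun i => \sum_j A i j).
by have [j ->] := mp_sum_max j0 (A i); exists i, j.
Qed.

Lemma mulmx_ge m n p (A : 'M[maxplus R]_(m, n)) (B : 'M_(n, p)) i j k :
  A i j * B j k <= (A *m B) i k.
Proof. by rewrite mxE; apply: (mp_le_sumT (fun j => A i j * B j k)). Qed.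

Lemma mulmx_max m n p (A : 'M[maxplus R]_(m, n)) (B : 'M_(n, p))
    (j0 : 'I_n) i k : exists j, (A *m B) i k = A i j * B j k.
Proof. by rewrite mxE; apply: (mp_sum_max j0 (fun j => A i j * B j k)). Qed.

Lemma mulmx_le m n p (A : 'M[maxplus R]_(m, n)) (B : 'M_(n, p)) i k z :
  (forall j, A i j * B j k <= z) -> (A *m B) i k <= z.
Proof. by move=> ABz; rewrite mxE; apply: mp_sum_le => j _. Qed.

End MaxPlusOrder.

(** * Walks, cycle excision and the asterate *)

Lemma not_uniq_split (T : eqType) (s : seq T) : ~~ uniq s ->
  exists x s1 s2 s3, s = s1 ++ x :: s2 ++ x :: s3.
Proof.
elim: s => //= x s IH; rewrite negb_and negbK.
case/orP=> [/splitPr[p1 p2]|/IH[y [s1 [s2 [s3 ->]]]]].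
  by exists x, [::], p1, p2.
by exists y, (x :: s1), s2, s3.
Qed.

Section Asterate.
Variables (R : realType) (n : nat) (C : 'M[maxplus R]_n).
Implicit Types (i j : 'I_n) (s : seq 'I_n).

(** The list [s] omits the starting vertex [i], so its size counts the edges of the walk. *)
Fixpoint path_weight i s : maxplus R :=
  if s is j :: s' then C i j * path_weight j s' else 1.

Lemma path_weight_cat i s1 s2 :
  path_weight i (s1 ++ s2) = path_weight i s1 * path_weight (last i s1) s2.
Proof.
by elim: s1 i => [|j s1 IH] i /=; rewrite ?mul1r ?IH ?mulrA.
Qed.

Lemma path_weight_le i s : path_weight i s <= (C ^+ size s) i (last i s).
Proof.
elim: s i => [|j s IH] i /=; first by rewrite expr0 mxE eqxx.
rewrite exprS; apply: le_trans (mulmx_ge _ _ _ j _).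
exact: mp_leM.
Qed.

(** Together with [path_weight_le], this makes an entry of [C ^+ k] the largest weight of a walk
    with [k] edges. A zero entry may have no walk at all, as for [k = 0] and [i] distinct from
    [j]. *)
Lemma expmx_path k i j : (C ^+ k) i j != 0 ->
  exists s, [/\ size s = k, last i s = j & path_weight i s = (C ^+ k) i j].
Proof.
elim: k i => [|k IH] i.
  rewrite expr0 mxE; have [-> _|_] := eqVneq i j; last by rewrite eqxx.
  by exists [::].
rewrite exprS; have [l ->] := mulmx_max C (C ^+ k) i i j.
rewrite mp_mul_eq0 negb_or => /andP[_ /IH[s [sz ls ws]]].
by exists (l :: s); rewrite /= sz ws.
Qed.

Lemma asterateE i j : asterate C i j = \sum_(k < n) (C ^+ k) i j.
Proof. by rewrite /asterate summxE. Qed.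

Lemma expmx_le_asterate k i j : (k < n)%N -> (C ^+ k) i j <= asterate C i j.
Proof.
move=> kn; rewrite asterateE.
exact: (mp_le_sumT (fun k : 'I_n => (C ^+ k) i j) (Ordinal kn)).
Qed.

Lemma asterate_diag i : (1 : maxplus R) <= asterate C i i.
Proof.
have := @expmx_le_asterate 0 i i (leq_ltn_trans (leq0n i) (ltn_ord i)).
by rewrite expr0 mxE eqxx.
Qed.

(** By the pigeonhole principle: [i :: s] lists more than [n] vertices, so one is visited twice, and
    [s2] is the cycle between two visits. *)
Lemma path_split i s : (n <= size s)%N -> exists s1 s2 s3,
  [/\ s = s1 ++ s2 ++ s3, s2 != [::] & last (last i s1) s2 = last i s1].
Proof.
move=> sz; have : ~~ uniq (i :: s).
  apply/negP=> /card_uniqP e; have := max_card (mem (i :: s)).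
  by rewrite e card_ord /= ltnNge sz.
(* The first of the two visits is either the start [i] itself or lies in [s]. *)
case/not_uniq_split=> x [[|a s1] [s2 [s3 /= [-> ->]]]].
  by exists [::], (rcons s2 x), s3; rewrite /= cat_rcons last_rcons; case: s2.
exists (rcons s1 x), (rcons s2 x), s3.
by rewrite !cat_rcons !last_rcons; case: s2.
Qed.

Hypothesis TrC : Tr C <= 1.

(** A closed walk with [k] edges is bounded by a diagonal entry of [C ^+ k], hence by its trace,
    which is a summand of [Tr C] for [k] from 1 to [n]. *)
Lemma cycle_weight_le1 i s : s != [::] -> (size s <= n)%N -> last i s = i ->
  path_weight i s <= 1.
Proof.
move=> s0 sn si; apply: le_trans TrC.
apply: le_trans (path_weight_le i s) _; rewrite si.
apply: le_trans (mp_le_sum (fun k => \tr (C ^+ k)) (i := size s) _).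
  by rewrite /mxtrace; apply: (mp_le_sumT (fun i => (C ^+ size s) i i)).
by rewrite mem_index_iota ltnS sn andbT lt0n size_eq0.
Qed.

(** The asterate stops at exponent [n - 1], so [C ^+ n] is the one power in [C *m asterate C] that
    is not already a summand of it. *)
Lemma expn_le_asterate i j : (C ^+ n) i j <= asterate C i j.
Proof.
have [->|/expmx_path[s [sz ls <-]]] := eqVneq ((C ^+ n) i j) 0.
  exact: mp_ge0.
have [|s1 [s2 [s3 [es s20 ls2]]]] := @path_split i s; first by rewrite sz.
have [szE s2_gt0] : size s = (size s1 + (size s2 + size s3))%N /\ (0 < size s2)%N.
  by rewrite es !size_cat lt0n size_eq0.
have szlt : (size (s1 ++ s3) < size s)%N.
  by rewrite szE size_cat ltn_add2l -[ltnLHS]add0n ltn_add2r.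
have sz2 : (size s2 <= size s)%N.
  by rewrite szE (leq_trans (leq_addr _ _) (leq_addl _ _)).
(* As [s] has [n] edges, the shortened walk has fewer than [n], and the cycle [s2] is short enough
   to be controlled by [Tr C]. *)
rewrite sz in szlt sz2.
apply: (@le_trans _ _ (path_weight i (s1 ++ s3))).
  rewrite es !path_weight_cat ls2; apply: mp_leM => //.
  rewrite -[leRHS]mul1r; apply: mp_leM => //; exact: cycle_weight_le1.
apply: le_trans (path_weight_le _ _) _.
have -> : last i (s1 ++ s3) = j by rewrite -ls es !last_cat ls2.
exact: expmx_le_asterate.
Qed.

Lemma mul_asterate_le i j : (C *m asterate C) i j <= asterate C i j.
Proof.
rewrite /asterate mulmx_sumr summxE; apply: mp_sum_le => k _.
have -> : C *m C ^+ k = C ^+ k.+1 by rewrite exprS.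
have := ltn_ord k; rewrite leq_eqVlt => /orP[/eqP->|kn].
  exact: expn_le_asterate.
exact: expmx_le_asterate.
Qed.

Lemma asterate_mul_subfix (u : 'cV[maxplus R]_n) i :
  (C *m (asterate C *m u)) i 0 <= (asterate C *m u) i 0.
Proof.
rewrite mulmxA; apply: mulmx_le => j.
apply: le_trans (mulmx_ge _ _ _ j _).
by apply: mp_leM; rewrite ?mul_asterate_le.
Qed.

End Asterate.

Lemma asterate_mul_ge (R : realType) n (C : 'M[maxplus R]_n)
    (u : 'cV[maxplus R]_n) i : u i 0 <= (asterate C *m u) i 0.
Proof.
apply: le_trans (mulmx_ge _ _ _ i _).
by rewrite -[leLHS]mul1r; apply: mp_leM; rewrite ?asterate_diag.
Qed.

(** Iterating the hypothesis bounds every [C ^+ k *m x] by [x]; the reverse inequality comes from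
    the diagonal of the asterate. *)
Lemma asterate_mul_id (R : realType) n (C : 'M[maxplus R]_n)
    (x : 'cV[maxplus R]_n) :
  (forall i, (C *m x) i 0 <= x i 0) -> asterate C *m x = x.
Proof.
move=> Cx; apply/colP=> i; apply/le_anti; rewrite asterate_mul_ge andbT.
rewrite /asterate mulmx_suml summxE; apply: mp_sum_le => k _.
elim: {k}(k : nat) i => [|k IH] i; first by rewrite expr0 mul1mx.
have -> : C ^+ k.+1 *m x = C *m (C ^+ k *m x) by rewrite exprS -mulmxA.
apply: le_trans (Cx i); apply: mulmx_le => j.
by apply: le_trans (mulmx_ge _ _ _ j _); apply: mp_leM.
Qed.

(** * Spread of the columns of [D] and of the vectors [D *m u] *)

Section Spread.
Variables (R : realType) (m n : nat).
Implicit Types (y : 'cV[maxplus R]_m) (u : 'cV[maxplus R]_n).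

Lemma objective_ge y p s : y p 0 * mp_inv (y s 0) <= objective y.
Proof.
apply: mp_leM; first exact: mx_norm_ge.
by have := mx_norm_ge (mx_conj y) 0 s; rewrite mxE.
Qed.

Lemma mx_norm_col_max y (i0 : 'I_m) : exists p, mx_norm y = y p 0.
Proof. by have [p [j ->]] := mx_norm_max y i0 0; exists p; rewrite ord1. Qed.

Lemma mx_norm_conj_max y (i0 : 'I_m) :
  exists s, mx_norm (mx_conj y) = mp_inv (y s 0).
Proof.
have [j [s ->]] := mx_norm_max (mx_conj y) 0 i0.
by exists s; rewrite mxE ord1.
Qed.

Lemma mx_norm_conjE y s :
  (forall i, mp_inv (y i 0) <= mp_inv (y s 0)) ->
  mx_norm (mx_conj y) = mp_inv (y s 0).
Proof.
move=> ys; have [t e] := mx_norm_conj_max y s.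
apply/le_anti; rewrite {1}e ys /=.
by have := mx_norm_ge (mx_conj y) 0 s; rewrite mxE.
Qed.

Variable D : 'M[maxplus R]_(m, n).
Local Notation Delta := (mx_norm (D *m mx_conj D)).

Lemma ratio_le_Delta i j k : D i j * mp_inv (D k j) <= Delta.
Proof.
apply: le_trans (mx_norm_ge _ i k).
by have := mulmx_ge D (mx_conj D) i j k; rewrite [mx_conj D _ _]mxE.
Qed.

Lemma objective_col_le (i0 : 'I_m) j : objective (col j D) <= Delta.
Proof.
rewrite /objective; have [p ->] := mx_norm_col_max (col j D) i0.
have [s ->] := mx_norm_conj_max (col j D) i0.
by rewrite !mxE ratio_le_Delta.
Qed.

(** A largest entry of [D *m mx_conj D] is attained at one summand, which is a ratio of two entries
    of a single column. *)
Lemma objective_col_max (i0 : 'I_m) (j0 : 'I_n) :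
  exists k, objective (col k D) = Delta.
Proof.
have [p [s e]] := mx_norm_max (D *m mx_conj D) i0 i0.
have [k ek] := mulmx_max D (mx_conj D) j0 p s.
exists k; apply/le_anti; rewrite objective_col_le //= e ek.
by have := objective_ge (col k D) p s; rewrite !mxE.
Qed.

Hypothesis D0 : forall i j, D i j != 0.

Lemma mulmx_regular u i (j0 : 'I_n) : regular u -> (D *m u) i 0 != 0.
Proof.
move=> u0; rewrite -mp_gt0; apply: lt_le_trans (mulmx_ge _ _ _ j0 _).
by rewrite mp_gt0 mp_mul_eq0 negb_or D0 u0.
Qed.

Lemma mulmx_ratio_le u p s k : regular u -> (D *m u) p 0 = D p k * u k 0 ->
  (D *m u) p 0 * mp_inv ((D *m u) s 0) <= D p k * mp_inv (D s k).
Proof.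
move=> u0 ->; apply: (@le_trans _ _ (D p k * u k 0 * mp_inv (D s k * u k 0))).
  apply: mp_leM => //; apply: mp_le_inv (mulmx_ge _ _ _ _ _).
  by rewrite mp_mul_eq0 negb_or D0 u0.
by rewrite mp_invM mulrACA mp_mulV ?mulr1.
Qed.

Lemma objective_mulmx_le u (i0 : 'I_m) (j0 : 'I_n) : regular u ->
  objective (D *m u) <= Delta.
Proof.
move=> u0; rewrite /objective; have [p ->] := mx_norm_col_max (D *m u) i0.
have [s ->] := mx_norm_conj_max (D *m u) i0.
have [k e] := mulmx_max D u j0 p 0.
exact: le_trans (mulmx_ratio_le s u0 e) (ratio_le_Delta _ _ _).
Qed.

Lemma objective_mulmx_eq u (i0 : 'I_m) (j0 : 'I_n) : regular u ->
  objective (D *m u) = Delta <->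
  exists (alpha : maxplus R) k s,
    [/\ (0 : maxplus R) < alpha,
        forall i, objective (col i D) <= objective (col k D),
        forall i, mp_inv (D i k) <= mp_inv (D s k),
        u k 0 = alpha * mx_norm (mx_conj (col k D)) &
        forall j, j != k -> u j 0 <= alpha * mp_inv (D s j)].
Proof.
move=> u0; split.
  rewrite /objective; have [p ->] := mx_norm_col_max (D *m u) i0.
  have [s ->] := mx_norm_conj_max (D *m u) i0.
  have [k e] := mulmx_max D u j0 p 0.
  have ys0 := mulmx_regular s j0 u0.
  (* The ratio in column [k] is squeezed between the objective, now equal to [Delta], and
     [Delta]. *)
  move=> eD; have eDk : D p k * mp_inv (D s k) = Delta.
    by apply/le_anti; rewrite ratio_le_Delta -eD mulmx_ratio_le.
  have min_s i : mp_inv (D i k) <= mp_inv (D s k).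
    by rewrite -(mp_leM2l _ _ (D0 p k)) eDk ratio_le_Delta.
  have ys : (D *m u) s 0 = D s k * u k 0.
    (* Both sides multiplied by [D p k] give [Delta], so [D p k] cancels. *)
    have /(congr1 (@mp_inv R)) : mp_inv ((D *m u) s 0) * u k 0 = mp_inv (D s k).
      by apply: (mp_mulI (D0 p k)); rewrite eDk -eD e mulrA mulrAC.
    rewrite mp_invM !mp_invK => <-.
    by rewrite mp_mulVK.
  exists ((D *m u) s 0), k, s; split=> //.
  - move=> i; apply: le_trans (objective_col_le i0 i) _.
    by rewrite -eDk; have := objective_ge (col k D) p s; rewrite !mxE.
  - rewrite (@mx_norm_conjE (col k D) s) => [|i]; last by rewrite !mxE.
    by rewrite ys [col k D s 0]mxE mulrAC mp_mulV ?mul1r.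
  - by move=> j _; rewrite mp_le_pdivl // mulmx_ge.
move=> [alpha [k [s [alpha0 max_k min_s uk uj]]]].
have normk : mx_norm (mx_conj (col k D)) = mp_inv (D s k).
  by rewrite (@mx_norm_conjE (col k D) s) => [|i]; rewrite !mxE.
have eDk : objective (col k D) = Delta.
  have [l el] := objective_col_max i0 j0.
  by apply/le_anti; rewrite objective_col_le //= -el max_k.
(* The conditions on [u] say that no term [D s j * u j 0] exceeds [alpha]. *)
have ys : (D *m u) s 0 <= alpha.
  apply: mulmx_le => j; rewrite -mp_le_pdivl //.
  by have [->|/uj//] := eqVneq j k; rewrite uk normk.
apply/le_anti; rewrite objective_mulmx_le //= -eDk.
(* With [p] a largest entry of column [k], entry [p] of [D *m u] is at least [D p k * u k 0] and
   entry [s] at most [alpha]; their ratio therefore reaches the spread of column [k]. *)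
have [p ep] := mx_norm_col_max (col k D) i0.
apply: le_trans (objective_ge _ p s).
apply: (@le_trans _ _ (D p k * u k 0 * mp_inv alpha)).
  rewrite mp_gt0 in alpha0.
  by rewrite /objective ep [col k D p 0]mxE uk [alpha * _]mulrC mulrA mp_mulKV.
by apply: mp_leM; [apply: mulmx_ge | apply: mp_le_inv; rewrite ?mulmx_regular].
Qed.

End Spread.

Theorem lemma7 (R : realType) (n : nat) (hn : (0 < n)%N)
    (A C : 'M[maxplus R]_n) (hA : row_regular A) (hC : Tr C <= 1) :
  let D := A *m asterate C in
  let Delta := mx_norm (D *m mx_conj D) in
  (forall j, regular (col j D)) ->
  is_maximum A C Delta /\
  (forall x : 'cV[maxplus R]_n, regular x ->
    ((exists y, feasible A C x y /\ objective y = Delta) <->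
     (exists u : 'cV[maxplus R]_n,
       [/\ regular u,
           x = asterate C *m u &
           exists (alpha : maxplus R) (k s : 'I_n),
             [/\ (0 : maxplus R) < alpha,
                 forall i, mx_norm (col i D) * mx_norm (mx_conj (col i D)) <=
                           mx_norm (col k D) * mx_norm (mx_conj (col k D)),
                 forall i, mp_inv (D i k) <= mp_inv (D s k),
                 u k 0 = alpha * mx_norm (mx_conj (col k D)) &
                 forall j, j != k -> u j 0 <= alpha * mp_inv (D s j)]]))).
Proof.
move=> D Delta Dreg; pose i0 := Ordinal hn.
have D0 i j : D i j != 0 by have := Dreg j i; rewrite mxE.
have yE (x y : 'cV_n) : feasible A C x y -> y = D *m x.
  by case=> _ <- Cx; rewrite /D -mulmxA asterate_mul_id.
have feasD (u : 'cV_n) : regular u -> feasible A C (asterate C *m u) (D *m u).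
  move=> u0; split=> [i||i]; last exact: asterate_mul_subfix.
    rewrite -mp_gt0; apply: lt_le_trans (asterate_mul_ge C u i).
    by rewrite mp_gt0.
  by rewrite mulmxA.
split; last first.
  move=> x x0; split=> [[y [fy oy]]|[u [u0 -> H]]].
    (* A feasible [x] is fixed by the asterate, so it serves as its own [u]. *)
    exists x; split=> //; first by case: fy => _ _ /asterate_mul_id.
    by apply/(objective_mulmx_eq D0 i0 i0 x0); rewrite -(yE _ _ fy).
  exists (D *m u); split; first exact: feasD.
  exact/(objective_mulmx_eq D0 i0 i0 u0).
split; last first.
  move=> x y fy; rewrite (yE _ _ fy).
  by apply: objective_mulmx_le => //; case: fy.
have [k ek] := objective_col_max D i0 i0.
have [s es] := mx_norm_conj_max (col k D) i0.
(* This [u] meets the stated conditions for [alpha = 1], with every inequality on its entries an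
   equality. *)
pose u : 'cV[maxplus R]_n := \col_j mp_inv (D s j).
have u0 : regular u by move=> j; rewrite mxE mp_inv_neq0.
exists (asterate C *m u), (D *m u); split; first exact: feasD.
apply/(objective_mulmx_eq D0 i0 i0 u0); exists 1, k, s; split=> [|i|i||j _].
- by rewrite mp_gt0 oner_neq0.
- by rewrite ek; apply: objective_col_le.
- by have := mx_norm_ge (mx_conj (col k D)) 0 i; rewrite es !mxE.
- by rewrite es mul1r !mxE.
- by rewrite mul1r mxE.
Qed.
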